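(* Let $n\geq 2$ and $1\le k\leq \lfloor \frac{n}{2} \rfloor$, and let $K_n$ be the complete graph on $n$ vertices. Then $\alpha(T_k(K_n)) = \frac{1}{k}\binom{n}{k-1}$ if and only if there exists a $t$-$(n,k,1)$ design with $t=k-1$.
   Context: For a graph $G$ with vertex set $V$ of size $n$ and $1\le k\le n-1$, the $k$-token graph $T_k(G)$ has as vertices the $k$-subsets of $V$, two of them adjacent if their symmetric difference is an edge of $G$. $\alpha(\Gamma)$ denotes the independence number of a graph $\Gamma$. A $t$-$(v,k,\lambda)$ design is a collection of $k$-subsets of a $v$-element set such that every $t$-subset is contained in exactly $\lambda$ of these $k$-subsets. *)

(* Defs.v *)
From HB Require Import structures.
From mathcomp Require Import all_boot all_order all_algebra.
Set Implicit Arguments.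
Unset Strict Implicit.
Unset Printing Implicit Defensive.

Record sgraph := SGraph {
  vertex :> finType;
  adj : rel vertex;
  adj_sym : symmetric adj;
  adj_irrefl : irreflexive adj }.

Section IndependenceNumber.
Variable G : sgraph.

Definition independent (S : {set G}) : bool :=
  [forall x in S, forall y in S, ~~ adj x y].

Definition alpha : nat := \max_(S : {set G} | independent S) #|S|.

End IndependenceNumber.

Section Complete.
Variable n : nat.

Definition complete_adj : rel 'I_n := [rel x y | x != y].

Lemma complete_adj_sym : symmetric complete_adj.
Proof. by move=> x y; rewrite /complete_adj /= eq_sym. Qed.

Lemma complete_adj_irrefl : irreflexive complete_adj.
Proof. by move=> x; rewrite /complete_adj /= eqxx. Qed.

Definition complete : sgraph := SGraph complete_adj_sym complete_adj_irrefl.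

End Complete.

Section SymmetricDifference.
Variable T : finType.
Implicit Types A B : {set T}.

Definition symdiff A B : {set T} := (A :\: B) :|: (B :\: A).

Lemma symdiffC A B : symdiff A B = symdiff B A.
Proof. exact: setUC. Qed.

Lemma symdiffxx A : symdiff A A = set0.
Proof. by rewrite /symdiff setDv setU0. Qed.

End SymmetricDifference.

Section TokenGraph.
Variables (k : nat) (G : sgraph).

Definition ksubset : finType := {A : {set G} | #|A| == k}.

Definition token_adj : rel ksubset := [rel A B |
  [exists x : G, exists y : G,
     adj x y && (symdiff (val A) (val B) == [set x; y])]].

Lemma token_adj_sym : symmetric token_adj.
Proof. by move=> A B; rewrite /token_adj /= symdiffC. Qed.

Lemma token_adj_irrefl : irreflexive token_adj.
Proof.
move=> A; apply/existsP => -[x /existsP[y /andP[_ /eqP]]].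
by rewrite symdiffxx => /setP/(_ x); rewrite !inE eqxx.
Qed.

Definition token_graph : sgraph := SGraph token_adj_sym token_adj_irrefl.

End TokenGraph.

Definition is_design (t v k lambda : nat) (X : finType)
    (D : {set {set X}}) : Prop :=
  [/\ #|X| = v,
      forall b, b \in D -> #|b| = k
    & forall A : {set X}, #|A| = t -> #|[set b in D | A \subset b]| = lambda].

(* Main.v *)
Require Import Defs.
From mathcomp Require Import all_boot all_order all_algebra.
Set Implicit Arguments.
Unset Strict Implicit.
Unset Printing Implicit Defensive.

(** Two distinct [k]-sets are adjacent in [T_k(K_n)] iff they share a
[(k-1)]-subset, so independent sets are the families [D] of [k]-sets in which
each [(k-1)]-set has degree at most [1].  Counting the pairs consisting of a
block and a [(k-1)]-subset of it in two ways, the degrees add up to [k * #|D|];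
hence [k * #|D| <= 'C(n, k - 1)], with equality iff all degrees are [1]. *)

Section Degree.
Variable T : finType.
Implicit Types (A B : {set T}) (D : {set {set T}}) (k : nat).

Definition degree D A : nat := #|[set b in D | A \subset b]|.

Lemma sum_degree D k : 0 < k -> (forall b, b \in D -> #|b| = k) ->
  \sum_(A : {set T} | #|A| == k - 1) degree D A = k * #|D|.
Proof.
move=> k_gt0 Dk; under eq_bigr => A _ do
  rewrite /degree -sum1dep_card big_mkcondr /=.
(* After the exchange, each block [b] counts its own [(k - 1)]-subsets, of which there are
   ['C(k, k - 1) = k]. *)
rewrite exchange_big /= mulnC -sum_nat_const; apply: eq_bigr => b /Dk bk.
rewrite -big_mkcondr sum1dep_card.
under eq_finset => A do rewrite andbC.
by rewrite cards_draws bk -{1}(subnK k_gt0) addn1 binSn -addn1 subnK.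
Qed.

Lemma degree_le1P D A :
  reflect {in D &, forall b c : {set T}, A \subset b -> A \subset c -> b = c}
          (degree D A <= 1).
Proof.
apply: (iffP card_le1P) => [le1 b c bD cD Ab Ac | inj b].
  have /le1 Eb : b \in [set b in D | A \subset b] by rewrite inE bD.
  by have := Eb c; rewrite !inE cD Ac => /esym/eqP.
rewrite inE => /andP[bD Ab] c; rewrite !inE.
apply/andP/eqP => [[cD Ac]|->//]; exact: inj.
Qed.

(** Equal cardinality makes [A :\: B] and [B :\: A] equally large, so the symmetric difference is a
    pair exactly when both are singletons, that is, when [A :&: B] has [k - 1] elements. *)
Lemma symdiff_eq_pairP (k : nat) A B : 0 < k -> #|A| = k -> #|B| = k ->
  (exists x y, x != y /\ symdiff A B = [set x; y]) <->
  (A != B /\ exists2 C : {set T}, #|C| = k - 1 & C \subset A :&: B).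
Proof.
move=> k0 Ak Bk.
have cA := cardsID B A; have cB := cardsID A B.
rewrite setIC in cB.
split=> [[x [y [xy E]]]|[AB [C Ck CAB]]].
  have cS : #|symdiff A B| = #|A :\: B| + #|B :\: A|.
    rewrite /symdiff cardsU; suff -> : (A :\: B) :&: (B :\: A) = set0.
      by rewrite cards0 subn0.
    by apply/setP => z; rewrite !inE; do 2 case: (z \in _).
  have AB1 : #|A :\: B| = 1.
    have eqD : #|A :\: B| = #|B :\: A|.
      by apply/eqP; rewrite -(eqn_add2l #|A :&: B|) cA cB Ak Bk.
    (* The size 2 is the double of [#|A :\: B|], which leaves only the value 1. *)
    move: cS; rewrite E cards2 xy -eqD addnn.
    by case: #|_| => [//|[//|m]].
  split; last by exists (A :&: B) => //; rewrite -Ak -cA AB1 addnK.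
  by apply/eqP => ABE; move: AB1; rewrite ABE setDv cards0.
(* Distinct [k]-sets meet in fewer than [k] points, while [C] provides at least [k - 1]. *)
have ltI : #|A :&: B| < k.
  rewrite ltn_neqAle -{2}Ak subset_leq_card ?subsetIl // andbT.
  apply: contraNneq AB => Ik; rewrite eqEcard Ak Bk leqnn andbT.
  by apply/setIidPl/eqP; rewrite eqEcard subsetIl Ak Ik leqnn.
have Ik : #|A :&: B| = k - 1.
  apply/eqP; rewrite eqn_leq -{2}Ck (subset_leq_card CAB) andbT.
  by rewrite subn1 -ltnS prednK.
have kE : k = k - 1 + 1 by rewrite subnK.
have /cards1P[x Ex] : #|A :\: B| == 1.
  by rewrite -(eqn_add2l (k - 1)) -kE -Ik cA Ak.
have /cards1P[y Ey] : #|B :\: A| == 1.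
  by rewrite -(eqn_add2l (k - 1)) -kE -Ik cB Bk.
exists x, y; split; last by rewrite /symdiff Ex Ey.
have : x \in A :\: B by rewrite Ex set11.
have : y \in B :\: A by rewrite Ey set11.
by rewrite !inE => /andP[_ yB] /andP[xB _]; apply: contraNneq xB => ->.
Qed.

Lemma leqif_packing D k : 0 < k -> (forall b, b \in D -> #|b| = k) ->
  (forall A, #|A| = k - 1 -> degree D A <= 1) ->
  k * #|D| <= 'C(#|T|, k - 1)
    ?= iff [forall (A : {set T} | #|A| == k - 1), degree D A == 1].
Proof.
move=> k_gt0 Dk D1.
rewrite -sum_degree // -card_draws -sum1dep_card.
apply: leqif_sum => A /eqP Ak; split=> //; exact: D1.
Qed.

End Degree.

(** Relabelling points along a bijection preserves designs. This moves a design on an arbitrary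
    point set to ['I_n], where the vertices of the token graph live. *)
Lemma is_design_transport (X Y : finType) t v k l (D : {set {set X}}) :
  #|Y| = v -> is_design t v k l D ->
  exists D' : {set {set Y}}, is_design t v k l D'.
Proof.
move=> Yv [Xv Dk Dl]; have XY : #|X| = #|Y| by rewrite Xv Yv.
pose f x := enum_val (cast_ord XY (enum_rank x)) : Y.
pose g y := enum_val (cast_ord (esym XY) (enum_rank y)) : X.
have gK : cancel g f by move=> y; rewrite /f /g enum_valK cast_ordKV enum_rankK.
have fK : cancel f g by move=> x; rewrite /f /g enum_valK cast_ordK enum_rankK.
have card_pre (b : {set Y}) : #|f @^-1: b| = #|b|.
  by apply: on_card_preimset; apply: onW_bij; exists g.
pose F (b : {set Y}) : {set X} := f @^-1: b.
pose G (b : {set X}) : {set Y} := g @^-1: b.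
have FK : cancel F G by move=> b; apply/setP => y; rewrite !inE gK.
have GK : cancel G F by move=> b; apply/setP => x; rewrite !inE fK.
exists (F @^-1: D); split=> // [b|A At]; first by rewrite inE => /Dk; rewrite card_pre.
rewrite -(Dl (F A)); last by rewrite card_pre.
(* [F] is a bijection on sets, so the blocks through [F A] can be counted by their preimages, the
   new blocks through [A]. *)
rewrite -(on_card_preimset (f := F)); last first.
  by apply: onW_bij; exists G.
apply: eq_card => b; rewrite !inE; congr (_ && _).
apply/subsetP/subsetP => Ab x; first by rewrite !inE => /Ab.
by move=> xA; have := Ab (g x); rewrite !inE gK; apply.
Qed.

Section CompleteToken.
Variables n k : nat.
Hypothesis k_gt0 : 0 < k.
Let G := token_graph k (complete n).

Definition blocks (S : {set G}) : {set {set 'I_n}} := [set val b | b in S].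

Lemma card_blocks S : #|blocks S| = #|S|.
Proof. by rewrite card_imset //; exact: val_inj. Qed.

Lemma blocks_card S b : b \in blocks S -> #|b| = k.
Proof. by case/imsetP => c _ ->; apply/eqP/(valP c). Qed.

Lemma independent_degreeP (S : {set G}) :
  reflect (forall A : {set 'I_n}, #|A| = k - 1 -> degree (blocks S) A <= 1)
          (independent S).
Proof.
have adjP (b c : G) : adj b c <->
    exists x y : 'I_n, x != y /\ symdiff (val b) (val c) = [set x; y].
  split=> [/existsP[x /existsP[y /andP[xy /eqP E]]]|[x [y [xy E]]]].
    by exists x, y.
  by apply/existsP; exists x; apply/existsP; exists y; rewrite E eqxx andbT.
have cardG (b : G) : #|val b| = k by apply/eqP/(valP b).
apply: (iffP idP) => [ind A Ak | deg1].
  apply/degree_le1P => _ _ /imsetP[b bS ->] /imsetP[c cS ->] Ab Ac.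
  apply/eqP/negPn/negP => bc.
  move/forall_inP/(_ b bS)/forall_inP/(_ c cS)/negP: ind; apply.
  apply/adjP/(symdiff_eq_pairP k_gt0); rewrite ?cardG //; split=> //.
  by exists A; rewrite // subsetI Ab.
apply/forall_inP => b bS; apply/forall_inP => c cS; apply/negP.
case/adjP/(symdiff_eq_pairP k_gt0); rewrite ?cardG // => bc [A Ak].
rewrite subsetI => /andP[Ab Ac]; move/negP: bc; apply; apply/eqP.
by have /degree_le1P := deg1 A Ak; apply; rewrite ?imset_f.
Qed.

Lemma alpha_attained : exists2 S : {set G}, independent S & alpha G = #|S|.
Proof.
rewrite /alpha.
have [|S iS ->] := @eq_bigmax_cond _ (@independent G) (fun S : {set G} => #|S|).
  (* A maximum is attained only over a nonempty family; the empty set is independent. *)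
  apply/card_gt0P; exists set0.
  by apply/forall_inP => x; rewrite inE.
by exists S.
Qed.

(** If the packing bound is met, the blocks of a maximum independent set form a design. Conversely,
    the blocks of a design form an independent set that meets the bound, hence a maximum one. *)
Lemma alpha_designP : k * alpha G = 'C(n, k - 1) <->
  exists D : {set {set 'I_n}}, is_design (k - 1) n k 1 D.
Proof.
have packing (S : {set G}) : independent S -> k * #|S| <= 'C(n, k - 1) ?= iff
    [forall (A : {set 'I_n} | #|A| == k - 1), degree (blocks S) A == 1].
  move/independent_degreeP => iS.
  rewrite -card_blocks -[X in 'C(X, _)]card_ord; apply: leqif_packing => //.
  exact: blocks_card.
have [S iS aS] := alpha_attained.
split=> [aC | [D [_ Dk D1]]].
  exists (blocks S); split; [exact: card_ord | exact: blocks_card | ].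
  move=> A /eqP Ak; apply/eqP.
  have := (packing S iS).2; rewrite -aS aC eqxx => /esym/forall_inP.
  exact.
pose S' : {set G} := [set b : G | val b \in D].
have bS' : blocks S' = D.
  apply/setP => b; apply/imsetP/idP => [[c] + ->|bD]; first by rewrite inE.
  by exists (exist _ b (introT eqP (Dk b bD))); rewrite ?inE.
have iS' : independent S'.
  by apply/independent_degreeP => A /D1; rewrite bS' /degree => ->.
have eS' : k * #|S'| = 'C(n, k - 1).
  apply/eqP; rewrite (packing S' iS').2 bS'.
  by apply/forall_inP => A /eqP/D1; rewrite /degree => ->.
apply/eqP; rewrite eqn_leq {1}aS (packing S iS).1 -eS' leq_mul2l.
by rewrite (leq_bigmax_cond (F := fun S : {set G} => #|S|)) ?orbT.
Qed.

End CompleteToken.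

Theorem theorem2p4 (n k : nat) (hn : 2 <= n) (hk1 : 1 <= k)
    (hk2 : k <= n %/ 2) :
  ((alpha (token_graph k (complete n)))%:R
     = k%:R^-1 * ('C(n, k - 1)%N)%:R :> rat)%R
  <-> exists (X : finType) (D : {set {set X}}), is_design (k - 1) n k 1 D.
Proof.
have k0 : (k%:R != 0 :> rat)%R by rewrite Num.Theory.pnatr_eq0 -lt0n.
(* Since [k] is nonzero in [rat], clearing the denominator turns the rational equation into one
   between naturals. *)
apply: (@iff_trans _ (k * alpha (token_graph k (complete n)) = 'C(n, k - 1))).
  split=> [E | <-]; last by rewrite GRing.natrM GRing.mulKf.
  apply/eqP; rewrite -(Num.Theory.eqr_nat rat) GRing.natrM E.
  by rewrite GRing.mulVKf.
apply: (iff_trans (alpha_designP n hk1)).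
split=> [[D dD] | [X [D dD]]]; first by exists 'I_n, D.
exact: is_design_transport (card_ord n) dD.
Qed.
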